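(* Tabularity in $\mathsf{NExt}(\mathsf{S4.3}_t)$ is decidable: given any formula $\phi$, it is decidable whether $\mathsf{S4.3}_t\oplus\phi$ is tabular.
   Context: Tense formulas use $\Box$ (future necessity) and a past possibility operator written here $\mathsf{P}$; $\mathsf{S4}_t=\mathsf{K}_t\oplus\{\Box p\to p,\Box p\to\Box\Box p\}$; $\mathsf{S4.3}_t$ is the tense logic of all reflexive transitive linear frames; $\mathsf{NExt}(L)$ is the set of all tense logics extending $L$; a logic is tabular if it is the logic of a single finite frame. *)

(* Defs.v *)
From mathcomp Require Import all_boot.
From mathcomp Require Import zify.
Set Implicit Arguments.
Unset Strict Implicit.
Unset Printing Implicit Defensive.

(** * Tense formulas *)

Inductive formula : Type :=
  | Var of nat
  | Bot
  | Imp of formula & formula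
  | Box of formula
  | PDia of formula. (* past possibility *)

Fixpoint subst (s : nat -> formula) (phi : formula) : formula :=
  match phi with
  | Var n => s n
  | Bot => Bot
  | Imp a b => Imp (subst s a) (subst s b)
  | Box a => Box (subst s a)
  | PDia a => PDia (subst s a)
  end.

(** * Tense logics *)

(* Modal formulas are treated as further atoms, so that [tautology] is "being
   an instance of a classical propositional tautology". *)
Fixpoint prop_eval (v : formula -> bool) (phi : formula) : bool :=
  match phi with
  | Bot => false
  | Imp a b => prop_eval v a ==> prop_eval v b
  | _ => v phi
  end.

Definition tautology (phi : formula) : Prop := forall v, prop_eval v phi.

(* [tl_adj] is the tense axiomatics for a language with [Box] and [PDia]
   primitive: it makes [PDia] the left adjoint of [Box], i.e. the diamond of
   the converse relation. *)
Record tense_logic (L : formula -> Prop) : Prop := TenseLogic {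
  tl_taut : forall phi, tautology phi -> L phi;
  tl_K : forall phi psi,
    L (Imp (Box (Imp phi psi)) (Imp (Box phi) (Box psi)));
  tl_adj : forall phi psi, L (Imp (PDia phi) psi) <-> L (Imp phi (Box psi));
  tl_mp : forall phi psi, L (Imp phi psi) -> L phi -> L psi;
  tl_nec : forall phi, L phi -> L (Box phi);
  tl_subst : forall s phi, L phi -> L (subst s phi)
}.

(* The least tense logic containing L and phi. *)
Definition oplus (L : formula -> Prop) (phi : formula) : formula -> Prop :=
  fun psi => forall L' : formula -> Prop,
    tense_logic L' -> (forall chi, L chi -> L' chi) -> L' phi -> L' psi.

(** * Kripke semantics *)

Record frame : Type := Frame {
  world :> Type;
  acc : world -> world -> Prop;
  world_inhabited : inhabited world
}.

Fixpoint sat (F : frame) (V : nat -> F -> Prop) (x : F) (phi : formula) : Prop :=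
  match phi with
  | Var n => V n x
  | Bot => False
  | Imp a b => sat V x a -> sat V x b
  | Box a => forall y, acc x y -> sat V y a
  | PDia a => exists2 y, acc y x & sat V y a
  end.

Definition valid (F : frame) (phi : formula) : Prop :=
  forall (V : nat -> F -> Prop) (x : F), sat V x phi.

Definition Log (C : frame -> Prop) (phi : formula) : Prop :=
  forall F, C F -> valid F phi.

Definition reflexive_frame (F : frame) : Prop := forall x : F, acc x x.

Definition transitive_frame (F : frame) : Prop :=
  forall x y z : F, acc x y -> acc y z -> acc x z.

Definition linear_frame (F : frame) : Prop :=
  forall x y : F, acc x y \/ acc y x.

Definition S43t : formula -> Prop :=
  Log (fun F => [/\ reflexive_frame F, transitive_frame F & linear_frame F]).

Definition tabular (L : formula -> Prop) : Prop :=
  exists (T : finType) (R : T -> T -> Prop) (T0 : inhabited T),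
    forall phi, L phi <-> valid (Frame R T0) phi.

(** * Decidability *)

(* The total recursive functions: the least class containing the initial
   functions and closed under composition, primitive recursion and
   minimization of regular functions. *)
Inductive recursive : forall n, (n.-tuple nat -> nat) -> Prop :=
  | rec_zero n : recursive (fun _ : n.-tuple nat => 0)
  | rec_succ : recursive (fun v : 1.-tuple nat => (thead v).+1)
  | rec_proj n (i : 'I_n) : recursive (fun v : n.-tuple nat => tnth v i)
  | rec_comp m n (f : m.-tuple nat -> nat) (g : 'I_m -> n.-tuple nat -> nat) :
      recursive f -> (forall i, recursive (g i)) ->
      recursive (fun v : n.-tuple nat => f [tuple g i v | i < m])
  | rec_prim n (f : n.-tuple nat -> nat) (g : n.+2.-tuple nat -> nat)
      (h : n.+1.-tuple nat -> nat) :
      recursive f -> recursive g ->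
      (forall v : n.-tuple nat, h [tuple of 0 :: v] = f v) ->
      (forall y (v : n.-tuple nat), h [tuple of y.+1 :: v] =
         g [tuple of y :: h [tuple of y :: v] :: v]) ->
      recursive h
  | rec_min n (f : n.+1.-tuple nat -> nat) (h : n.-tuple nat -> nat) :
      recursive f ->
      (forall v : n.-tuple nat, f [tuple of h v :: v] = 0) ->
      (forall (v : n.-tuple nat) z, z < h v -> f [tuple of z :: v] <> 0) ->
      recursive h.

Definition cantor_pair (a b : nat) : nat := ((a + b) * (a + b).+1)./2 + a.

Fixpoint code (phi : formula) : nat :=
  match phi with
  | Bot => 0
  | Var n => (4 * n).+1
  | Imp a b => (4 * cantor_pair (code a) (code b)).+2
  | Box a => (4 * code a).+3
  | PDia a => (4 * code a).+4
  end.

Lemma cantor_pair_inj a b c d :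
  cantor_pair a b = cantor_pair c d -> a = c /\ b = d.
Proof.
have tri n : (n.+1 * n.+2)./2 = (n * n.+1)./2 + n.+1.
  have -> : n.+1 * n.+2 = n.+1.*2 + n * n.+1 by lia.
  by rewrite halfD odd_double add0n doubleK addnC.
pose t n := (n * n.+1)./2; rewrite /cantor_pair -!/(t _).
have {}tri n : t n.+1 = t n + n.+1 by exact: tri.
move: t tri => t tri.
have mono m n : m < n -> t m + m < t n.
  by elim: n => // n IHn; rewrite ltnS leq_eqVlt tri => /orP[/eqP->|/IHn]; lia.
case: (ltngtP (a + b) (c + d)) => [/mono|/mono|E]; rewrite ?E; lia.
Qed.

Lemma code_inj : injective code.
Proof.
elim=> [n||a IHa b IHb|a IHa|a IHa] [m||c d|c|c] //= E; try lia.
- by congr Var; lia.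
- have [|/IHa-> /IHb-> //] := @cantor_pair_inj (code a) (code b) (code c) (code d).
  by lia.
- by congr Box; apply: IHa; lia.
- by congr PDia; apply: IHa; lia.
Qed.

(* Recursiveness of f is essential: under classical choice every predicate has
   a characteristic function in the function space. *)
Definition decidable_formulas (P : formula -> Prop) : Prop :=
  exists2 f : 1.-tuple nat -> nat, recursive f &
    forall phi, (P phi -> f [tuple code phi] = 1) /\
                (~ P phi -> f [tuple code phi] = 0).

(* Main.v *)
Require Import Defs.
From mathcomp Require Import all_boot.
From mathcomp Require Import zify boolp.
Set Implicit Arguments.
Unset Strict Implicit.
Unset Printing Implicit Defensive.

(* S4.3t + phi is tabular iff it is consistent and phi is refuted in each of
   five families of finite frames: the finite chains, and the finite clusters
   with or without an extra first world and an extra last world.  These are the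
   pretabular logics above S4.3t.

   If phi is refuted in all of them, consider a connected canonical model W of
   the logic, a linear frame whose worlds are separated, and whose order is
   determined, by formulas.  A definable bounded morphism from W onto a finite
   frame transfers validity of phi.  Long strict chains in W would give a
   definable map onto a long chain; so W has boundedly many clusters, each of
   them definable, and a cluster with many worlds would give a definable map
   onto a large cluster, the worlds before (after) it being sent to a first
   (last) world.  So W is finite, of size bounded in terms of phi.

   Conversely a tabular logic contains a formula bounding the number of worlds
   of a linear frame, which fails in each family.

   Refutability in a family is decidable: by selecting extremal witnesses, a
   refuting frame can be shrunk to a number of worlds linear in the code of
   phi, and the truth tables on a frame of given size can be searched. *)

(** * Recursive functions *)

(** Asking for every arity at once lets [f] be used in environments that grow under binders, with
    variables as de Bruijn indices. *)
Definition env_recursive (f : seq nat -> nat) : Prop :=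
  forall n, recursive (fun v : n.-tuple nat => f v).

Lemma eq_recursive n (f g : n.-tuple nat -> nat) :
  f =1 g -> recursive f -> recursive g.
Proof. by move=> /funext ->. Qed.

Lemma recursive_subst m n (f : seq nat -> nat) (g : nat -> seq nat -> nat)
    (h : seq nat -> seq nat) :
  env_recursive f -> (forall i, env_recursive (g i)) ->
  (forall v : n.-tuple nat, h v = [seq g i v | i <- iota 0 m]) ->
  recursive (fun v : n.-tuple nat => f (h v)).
Proof.
move=> rf rg eq_h.
have := rec_comp (rf m) (fun i : 'I_m => rg i n); apply: eq_recursive => v /=.
congr f; rewrite eq_h -val_enum_ord -map_comp; exact: eq_map.
Qed.

Lemma env_recursive_var i : env_recursive (fun e => nth 0 e i).
Proof.
move=> n; have [lt_i_n|le_n_i] := ltnP i n.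
  apply: eq_recursive (rec_proj (Ordinal lt_i_n)) => v; exact: tnth_nth.
by apply: eq_recursive (rec_zero n) => v; rewrite nth_default ?size_tuple.
Qed.

Lemma env_recursive_succ f : env_recursive f -> env_recursive (fun e => (f e).+1).
Proof.
move=> rf n; apply: eq_recursive (rec_comp rec_succ (fun=> rf n)) => v.
by rewrite /thead tnth_mktuple.
Qed.

Lemma env_recursive_app f a b :
  env_recursive f -> env_recursive a -> env_recursive b ->
  env_recursive (fun e => f [:: a e; b e]).
Proof.
move=> rf ra rb n.
apply: (@recursive_subst 2 n f (fun i => if i == 0 then a else b)
  (fun e => [:: a e; b e])) => //; by case.
Qed.

Lemma env_recursive_iteri b f g :
  env_recursive b -> env_recursive f -> env_recursive g ->
  env_recursive
    (fun e => iteri (b e) (fun i acc => g [:: i, acc & e]) (f e)).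
Proof.
move=> rb rf rg n.
pose h (w : n.+1.-tuple nat) :=
  iteri (thead w) (fun i acc => g [:: i, acc & behead w]) (f (behead w)).
have rh : recursive h by exact: (rec_prim (rf n) (rg n.+2)).
(* Primitive recursion iterates on the first argument; composing with [a] puts the bound [b v]
   there, in front of [v]. *)
pose a (i : 'I_n.+1) (v : n.-tuple nat) := nth 0 (b v :: v) i.
have ra i : recursive (a i).
  rewrite /a; case: i => -[|i] lt_i /=; first exact: rb.
  exact: env_recursive_var.
apply: eq_recursive (rec_comp rh ra) => v; rewrite /h.
have -> : [tuple a i v | i < n.+1] = [tuple of b v :: v].
  apply: eq_from_tnth => i; rewrite tnth_mktuple /a; symmetry; exact: tnth_nth.
by rewrite theadE.
Qed.

(* Skips the accumulator of a recursion step, so that a bounded quantifier binds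
   a single variable. *)
Lemma env_recursive_skip f :
  env_recursive f -> env_recursive (fun e => f (nth 0 e 0 :: drop 2 e)).
Proof.
move=> rf n; apply: (@recursive_subst (n - 2).+1 n f
  (fun i e => nth 0 e (if i == 0 then 0 else i.+1))
  (fun e => nth 0 e 0 :: drop 2 e)) => // [i|v].
  exact: env_recursive_var.
rewrite /=; congr cons; apply: (@eq_from_nth _ 0) => [|i].
  by rewrite size_drop size_map size_iota size_tuple.
rewrite size_drop size_tuple => lt_i; rewrite nth_drop.
by rewrite (nth_map 0) ?size_iota // nth_iota.
Qed.

(** The decision procedure is written as a term, so that its recursiveness follows from one
    induction on terms. The step of [TRec] sees the counter, then the accumulator; [TApp] runs its
    body in a fresh environment holding just the two arguments. *)
Inductive term : Type :=
  | TVar of nat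
  | TZero
  | TSucc of term
  | TRec of term & term & term
  | TApp of term & term & term
  | TAll of term & term.

Fixpoint eval (t : term) (e : seq nat) : nat :=
  match t with
  | TVar i => nth 0 e i
  | TZero => 0
  | TSucc t => (eval t e).+1
  | TRec b t0 t1 =>
      iteri (eval b e) (fun i acc => eval t1 [:: i, acc & e]) (eval t0 e)
  | TApp f a b => eval f [:: eval a e; eval b e]
  | TAll b t => all (fun i => eval t (i :: e) != 0) (iota 0 (eval b e))
  end.

Definition holds (t : term) (e : seq nat) : bool := eval t e != 0.

Definition tconst k := iter k TSucc TZero.
(** Inside a recursion step under [TApp], index 0 is the counter, 1 the accumulator, 2 and 3 the two
    arguments. *)
Definition tadd a b := TApp (TRec (TVar 1) (TVar 0) (TSucc (TVar 1))) a b.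
Definition tmul a b := TApp (TRec (TVar 1) TZero (tadd (TVar 1) (TVar 2))) a b.
Definition tpred a := TApp (TRec (TVar 0) TZero (TVar 0)) a TZero.
Definition tsub a b := TApp (TRec (TVar 1) (TVar 0) (tpred (TVar 1))) a b.
Definition tnot a := tsub (TSucc TZero) a.
Definition tle a b := tnot (tsub a b).
Definition timp a b := tadd (tnot a) b.
Definition tiff a b := tmul (timp a b) (timp b a).
Definition tex b t := tnot (TAll b (tnot t)).
Definition todd a := TApp (TRec (TVar 0) TZero (tnot (TVar 1))) a TZero.
Definition thalf a :=
  TApp (TRec (TVar 0) TZero (tadd (TVar 1) (todd (TVar 0)))) a TZero.
Definition tbit z i := todd (TApp (TRec (TVar 1) (TVar 0) (thalf (TVar 1))) z i).
Definition tpow2 a :=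
  TApp (TRec (TVar 0) (TSucc TZero) (tadd (TVar 1) (TVar 1))) a TZero.

Section Eval.
Implicit Types (e : seq nat) (a b t : term).

Lemma eval_const e k : eval (tconst k) e = k.
Proof. by elim: k => //= k ->. Qed.

Lemma eval_add e a b : eval (tadd a b) e = eval a e + eval b e.
Proof. by rewrite /=; elim: (eval b e) => [|k IHk] /=; rewrite ?addn0 // IHk addnS. Qed.

Lemma eval_mul e a b : eval (tmul a b) e = eval a e * eval b e.
Proof.
rewrite [LHS]/=; elim: (eval b e) => [|k IHk]; first by rewrite muln0.
rewrite [LHS]/= IHk mulnS addnC.
exact: (eval_add [:: k; eval a e * k; eval a e; eval b e] (TVar 1) (TVar 2)).
Qed.

Lemma eval_pred e a : eval (tpred a) e = (eval a e).-1.
Proof. by rewrite /=; case: (eval a e). Qed.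

Lemma eval_sub e a b : eval (tsub a b) e = eval a e - eval b e.
Proof.
rewrite [LHS]/=; elim: (eval b e) => [|k IHk]; first by rewrite subn0.
rewrite [LHS]/= IHk subnS.
exact: (eval_pred [:: k; eval a e - k; eval a e; eval b e] (TVar 1)).
Qed.

Lemma eval_not e a : eval (tnot a) e = ~~ holds a e.
Proof. by rewrite eval_sub /holds /=; case: (eval a e). Qed.

Lemma holds_not e a : holds (tnot a) e = ~~ holds a e.
Proof. by rewrite {1}/holds eval_not eqb0 negbK. Qed.

Lemma holds_le e a b : holds (tle a b) e = (eval a e <= eval b e).
Proof. by rewrite holds_not /holds eval_sub negbK. Qed.

Lemma holds_add e a b : holds (tadd a b) e = holds a e || holds b e.
Proof. by rewrite /holds eval_add addn_eq0 negb_and. Qed.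

Lemma holds_mul e a b : holds (tmul a b) e = holds a e && holds b e.
Proof. by rewrite /holds eval_mul muln_eq0 negb_or. Qed.

Lemma holds_imp e a b : holds (timp a b) e = (holds a e ==> holds b e).
Proof. by rewrite holds_add holds_not implybE. Qed.

Lemma holds_iff e a b : holds (tiff a b) e = (holds a e == holds b e).
Proof. by rewrite holds_mul !holds_imp; case: (holds a e); case: (holds b e). Qed.

Lemma holds_all e b t :
  holds (TAll b t) e = all (fun i => holds t (i :: e)) (iota 0 (eval b e)).
Proof. by rewrite {1}/holds /= eqb0 negbK. Qed.

Lemma holds_ex e b t :
  holds (tex b t) e = has (fun i => holds t (i :: e)) (iota 0 (eval b e)).
Proof.
rewrite holds_not holds_all -has_predC; apply: eq_has => i /=.
by rewrite holds_not negbK.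
Qed.

Lemma eval_odd e a : eval (todd a) e = odd (eval a e).
Proof.
rewrite [LHS]/=; elim: (eval a e) => // k IHk.
have /= := eval_not [:: k; nat_of_bool (odd k)] (TVar 1).
by rewrite IHk /holds /= eqb0 negbK => ->.
Qed.

Lemma eval_half e a : eval (thalf a) e = (eval a e)./2.
Proof.
rewrite [LHS]/=; elim: (eval a e) => // k IHk.
rewrite [LHS]/= IHk.
apply: etrans (eval_add [:: k; k./2] (TVar 1) (todd (TVar 0))) _.
by rewrite eval_odd /= uphalf_half addnC.
Qed.

Lemma holds_bit e z i :
  holds (tbit z i) e = odd (iter (eval i e) half (eval z e)).
Proof.
rewrite /holds eval_odd eqb0 negbK; congr odd; rewrite [LHS]/=.
elim: (eval i e) => // k IHk.
rewrite [LHS]/= IHk.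
exact: (eval_half [:: k; iter k half (eval z e)] (TVar 1)).
Qed.

Lemma eval_pow2 e a : eval (tpow2 a) e = 2 ^ eval a e.
Proof.
rewrite [LHS]/=; elim: (eval a e) => // k IHk.
rewrite [LHS]/= IHk expnS mul2n -addnn.
exact: (eval_add [:: k; 2 ^ k] (TVar 1) (TVar 1)).
Qed.

End Eval.

Lemma env_recursive_eval t : env_recursive (eval t).
Proof.
(* A bounded quantifier is a product of truth values: the step multiplies the accumulator, entry 1,
   by the truth value of the body, from which the accumulator is hidden. *)
have and_rec f : env_recursive f ->
    env_recursive (fun e => nth 0 e 1 * (f (nth 0 e 0 :: drop 2 e) != 0)).
  move=> rf n.
  have zero : env_recursive (fun=> 0) by exact: (@rec_zero).
  (* A conditional as an iteration: the step always returns entry 1 of [e], so the result is that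
     entry after at least one round and 0 after none. *)
  apply: eq_recursive
    (env_recursive_iteri (env_recursive_skip rf) zero (env_recursive_var 3) n) => v.
  by case: (f _) => [|k] /=; rewrite ?muln0 ?muln1.
elim: t => /= [i||t IHt|b IHb f IHf g IHg|f IHf a IHa b IHb|b IHb t IHt].
- exact: env_recursive_var.
- exact: (@rec_zero).
- exact: env_recursive_succ.
- exact: env_recursive_iteri.
- exact: env_recursive_app.
- have one : env_recursive (fun=> 1) by apply: env_recursive_succ; exact: (@rec_zero).
  move=> n; apply: eq_recursive (env_recursive_iteri IHb one (and_rec _ IHt) n) => v.
  elim: (eval b v) => // k IHk.
  have -> : iota 0 k.+1 = rcons (iota 0 k) k by rewrite -cats1 -addn1 iotaD.
  by rewrite all_rcons andbC -mulnb -IHk /= drop0.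
Qed.

(** * Deciding refutability on a finite frame *)

(* [zframe false l r n] is a chain of n + 1 worlds; in [zframe true l r n] the
   first l and the last r worlds precede and follow a cluster of the others. *)
Definition zacc (s : bool) (l r n : nat) (x y : nat) : bool :=
  (x <= y) || [&& s, l <= y & x + r <= n].

Definition zframe s l r n : frame :=
  @Frame 'I_n.+1 (fun x y => zacc s l r n x y) (inhabits ord0).

Lemma cantor_pair_ge a b : a <= cantor_pair a b /\ b <= cantor_pair a b.
Proof.
rewrite /cantor_pair; split; first exact: leq_addl.
case: (posnP (a + b)) => [|lt0]; first lia.
have : a + b <= ((a + b) * (a + b).+1)./2.
  rewrite -[leqLHS]doubleK half_leq // -muln2 leq_mul2l; lia.
lia.
Qed.

Lemma cantor_pair_surj q : exists a b, cantor_pair a b = q.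
Proof.
elim: q => [|q [a [[|b] <-]]]; first by exists 0, 0.
  exists 0, a.+1; rewrite /cantor_pair add0n !addn0.
  have -> : a.+1 * a.+2 = a.+1.*2 + a * a.+1 by lia.
  by rewrite halfD odd_double add0n doubleK addnC; lia.
exists a.+1, b; rewrite /cantor_pair addSnnS; lia.
Qed.

(** Lets quantifiers over numbers up to a code be read as quantifiers over formulas. The residue of
    the predecessor modulo 4 selects the constructor. *)
Lemma code_surj d : exists phi, code phi = d.
Proof.
elim/ltn_ind: d => -[|d] IHd; first by exists Bot.
have IH q : q <= d -> exists phi, code phi = q by move=> /IHd.
have := divn_eq d 4; move: (d %/ 4) (ltn_mod d 4) => q; case: (d %% 4) => [|[|[|[|//]]]] _ Ed.
- by exists (Var q) => /=; lia.
- have [a [b Eq]] := cantor_pair_surj q; have [lea leb] := cantor_pair_ge a b.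
  have [|phi Ea] := IH a; first lia.
  have [|psi Eb] := IH b; first lia.
  by exists (Imp phi psi); rewrite /= Ea Eb Eq; lia.
- by have [|phi Ea] := IH q; first lia; exists (Box phi); rewrite /= Ea; lia.
- by have [|phi Ea] := IH q; first lia; exists (PDia phi); rewrite /= Ea; lia.
Qed.

(* z codes in binary the truth values, at the worlds x <= n, of the formulas with
   code d. *)
Definition tcell n z d x := tbit z (tadd (tmul d (TSucc n)) x).

Definition cell n z d x : bool := odd (iter (d * n.+1 + x) half z).

Lemma holds_cell e n z d x :
  holds (tcell n z d x) e =
  cell (eval n e) (eval z e) (eval d e) (eval x e).
Proof. by rewrite holds_bit eval_add eval_mul. Qed.

Definition tacc (s : bool) l r n x y :=
  tadd (tle x y)
    (if s then tmul (tle (tconst l) y) (tle (tadd x (tconst r)) n) else TZero).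

Lemma holds_acc e s l r n x y :
  holds (tacc s l r n x y) e = zacc s l r (eval n e) (eval x e) (eval y e).
Proof.
rewrite /tacc holds_add holds_le /zacc; congr orb.
by case: s => //; rewrite holds_mul !holds_le eval_add !eval_const.
Qed.

(** The factor 4 clears the halving: [4 * cantor_pair a b] is
    [2 * ((a + b) * (a + b).+1) + 4 * a]. *)
Definition tcodeImp a b :=
  tadd (tmul (tconst 2) (tmul (tadd a b) (TSucc (tadd a b))))
       (tadd (tmul (tconst 4) a) (tconst 2)).

Lemma eval_codeImp e a b :
  eval (tcodeImp a b) e = (4 * cantor_pair (eval a e) (eval b e)).+2.
Proof.
rewrite /tcodeImp !eval_add !eval_mul !eval_const.
have -> : eval (TSucc (tadd a b)) e = (eval (tadd a b) e).+1 by [].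
rewrite !eval_add /cantor_pair; move: (eval a e) (eval b e) => {a b} a b.
have ev : odd ((a + b) * (a + b).+1) = false by rewrite oddM /= andbN.
have := odd_double_half ((a + b) * (a + b).+1); rewrite ev add0n => {ev}.
rewrite -[X in _ = X -> _]mulnC; lia.
Qed.

Definition tcode_unary a k := tadd (tmul (tconst 4) a) (tconst k).

Lemma eval_code_unary e a k : eval (tcode_unary a k) e = 4 * eval a e + k.
Proof. by rewrite eval_add eval_mul !eval_const. Qed.

(* The environment is [:: x; b; a; z; n; c]. *)
Definition tlocal s l r :=
  let x := TVar 0 in let b := TVar 1 in let a := TVar 2 in
  let T := tcell (TVar 4) (TVar 3) in let c := TVar 5 in
  let T' := tcell (TVar 5) (TVar 4) in
  tmul (tnot (T TZero x))
  (tmul (timp (tle (tcodeImp a b) c) (tiff (T (tcodeImp a b) x) (timp (T a x) (T b x))))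
  (tmul (timp (tle (tcode_unary a 3) c)
     (tiff (T (tcode_unary a 3) x)
       (TAll (TSucc (TVar 4))
         (timp (tacc s l r (TVar 5) (TVar 1) (TVar 0)) (T' (TVar 3) (TVar 0))))))
   (timp (tle (tcode_unary a 4) c)
     (tiff (T (tcode_unary a 4) x)
       (tex (TSucc (TVar 4))
         (tmul (tacc s l r (TVar 5) (TVar 0) (TVar 1)) (T' (TVar 3) (TVar 0)))))))).

(** The truth clauses at [x] for the formulas built from those coded by [a] and [b], each required
    only for codes up to [c]; 0 codes [Bot]. Variables get no clause: their rows are the
    valuation. *)
Definition local_ok s l r n c (T : nat -> nat -> bool) a b x :=
  [&& ~~ T 0 x,
      ((4 * cantor_pair a b).+2 <= c) ==>
        (T (4 * cantor_pair a b).+2 x == (T a x ==> T b x)),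
      (4 * a + 3 <= c) ==>
        (T (4 * a + 3) x
         == all (fun y => zacc s l r n x y ==> T a y) (iota 0 n.+1)) &
      (4 * a + 4 <= c) ==>
        (T (4 * a + 4) x
         == has (fun y => zacc s l r n y x && T a y) (iota 0 n.+1))].

Lemma holds_local s l r n c z a b x :
  holds (tlocal s l r) [:: x; b; a; z; n; c] =
  local_ok s l r n c (cell n z) a b x.
Proof.
rewrite /tlocal !holds_mul !holds_imp !holds_iff !holds_le holds_not !holds_cell.
rewrite !holds_imp !holds_cell !eval_code_unary !eval_codeImp holds_all holds_ex /local_ok.
under eq_all => y do rewrite holds_imp holds_acc holds_cell.
by under eq_has => y do rewrite holds_mul holds_acc holds_cell.
Qed.

(* The environment is [:: n; c]. *)
Definition trefutes s l r :=
  tex (tpow2 (tmul (TSucc (TVar 1)) (TSucc (TVar 0))))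
   (tmul
     (TAll (TSucc (TVar 2)) (TAll (TSucc (TVar 3)) (TAll (TSucc (TVar 3))
        (tlocal s l r))))
     (tex (TSucc (TVar 1)) (tnot (tcell (TVar 2) (TVar 1) (TVar 3) (TVar 0))))).

Lemma holds_refutesE s l r n c :
  holds (trefutes s l r) [:: n; c] <->
  exists2 z, z < 2 ^ (c.+1 * n.+1) &
    (forall a b x, a <= c -> b <= c -> x <= n ->
       local_ok s l r n c (cell n z) a b x) /\
    (exists2 x, x <= n & ~~ cell n z c x).
Proof.
rewrite /trefutes holds_ex eval_pow2 eval_mul; split.
  case/hasP => z; rewrite mem_iota /= => lt_z.
  rewrite holds_mul => /andP[ok /[!holds_ex]/hasP[x]].
  rewrite mem_iota holds_not holds_cell => lt_x /= nT.
  exists z => //; split; last by exists x.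
  move=> a b y le_a le_b le_y.
  move: ok; rewrite holds_all => /allP/(_ a); rewrite mem_iota => /(_ le_a).
  rewrite holds_all => /allP/(_ b); rewrite mem_iota => /(_ le_b).
  rewrite holds_all => /allP/(_ y); rewrite mem_iota => /(_ le_y).
  by rewrite holds_local.
case=> z lt_z [ok [x le_x nT]]; apply/hasP; exists z; first by rewrite mem_iota.
rewrite holds_mul; apply/andP; split; last first.
  rewrite holds_ex; apply/hasP; exists x; first by rewrite mem_iota.
  by rewrite holds_not holds_cell.
rewrite holds_all; apply/allP => a; rewrite mem_iota => le_a.
rewrite holds_all; apply/allP => b; rewrite mem_iota => le_b.
rewrite holds_all; apply/allP => y; rewrite mem_iota => le_y.
by rewrite holds_local ok.
Qed.

Lemma bits_surj m (f : nat -> bool) :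
  exists2 z, z < 2 ^ m & forall i, i < m -> odd (iter i half z) = f i.
Proof.
elim: m f => [|m IHm] f; first by exists 0.
have [z lt_z fz] := IHm (fun i => f i.+1).
exists (f 0 + z.*2) => [|[|i] lt_i].
- by rewrite expnS; case: (f 0); lia.
- by rewrite /= oddD odd_double addbF oddb.
- by rewrite iterSr half_bit_double fz.
Qed.

Definition refuted (F : frame) phi := ~ valid F phi.

Lemma refutedP F phi :
  refuted F phi <-> exists (V : nat -> F -> Prop) (x : F), ~ sat V x phi.
Proof.
split=> [nval|[V [x nsat]] val]; last exact/nsat/val.
by apply: contra_notP nval => nex V x; apply: contrapT => nsat; apply: nex; exists V, x.
Qed.

(** The variable rows of a locally correct table give a valuation, and the clauses force all other
    rows up to [c] by induction on formulas. Conversely, the truth values under a refuting valuation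
    are tabulated. *)
Lemma holds_refutes s l r n phi :
  holds (trefutes s l r) [:: n; code phi] <-> refuted (zframe s l r n) phi.
Proof.
rewrite holds_refutesE refutedP; set c := code phi; split.
  case=> z _ [ok [x0 le_x0 nT]].
  pose T := cell n z; pose V p (x : zframe s l r n) := T (code (Var p)) (x : 'I__) : Prop.
  suff satT psi : code psi <= c -> forall x : 'I_n.+1,
      sat (F := zframe s l r n) V x psi <-> T (code psi) x.
    by exists V, (Ordinal (le_x0 : x0 < n.+1)) => /satT => /(_ (leqnn _)); rewrite /T (negPf nT).
  elim: psi => [p||a IHa b IHb|a IHa|a IHa] le_c x //=.
  - have /and4P[nT0 _ _ _] := ok 0 0 x (leq0n _) (leq0n _) (ltn_ord x).
    by rewrite /T (negPf nT0).
  - have [lea leb] := cantor_pair_ge (code a) (code b); rewrite /= in le_c.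
    have le_a : code a <= c by lia.
    have le_b : code b <= c by lia.
    have /and4P[_ ok1 _ _] := ok _ _ x le_a le_b (ltn_ord x).
    move: ok1; rewrite le_c /= => /eqP; rewrite -/T => ->; rewrite IHa // IHb //.
    by split=> /implyP.
  - rewrite /= in le_c; have le_a : code a <= c by lia.
    have /and4P[_ _ ok1 _] := ok _ _ x le_a (leq0n _) (ltn_ord x).
    move: ok1; rewrite addn3 le_c implyTb => /eqP; rewrite -/T => ->; split.
      move=> H; apply/allP => y; rewrite mem_iota => le_y; apply/implyP => xy.
      exact/(IHa le_a (Ordinal (le_y : y < n.+1)))/H.
    move=> /allP H y xy; apply/(IHa le_a); apply: (implyP (H y _)) => //.
    by rewrite mem_iota ltn_ord.
  - rewrite /= in le_c; have le_a : code a <= c by lia.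
    have /and4P[_ _ _ ok1] := ok _ _ x le_a (leq0n _) (ltn_ord x).
    move: ok1; rewrite addn4 le_c implyTb => /eqP; rewrite -/T => ->; split.
      case=> y yx /(IHa le_a) Ty; apply/hasP; exists (y : nat).
        by rewrite mem_iota ltn_ord.
      exact/andP.
    case/hasP => y; rewrite mem_iota => le_y /andP[yx Ty].
    by exists (Ordinal (le_y : y < n.+1)) => //; apply/(IHa le_a).
case=> V [x0 nsat].
(* Bit [i] belongs to the formula coded by the quotient of [i] by [n + 1] and to the world given by
   the remainder. *)
pose Q i := `[< exists psi (y : zframe s l r n),
  [/\ code psi = i %/ n.+1, nat_of_ord y = i %% n.+1 & sat V y psi] >].
have [z lt_z bitz] := bits_surj (c.+1 * n.+1) Q.
have cellP psi (x : 'I_n.+1) : code psi <= c ->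
    cell n z (code psi) x = `[< sat (F := zframe s l r n) V x psi >].
  move=> le_d; have le_x := ltn_ord x; rewrite /cell bitz; last first.
    by rewrite mulSn addnC -addSn leq_add // leq_mul2r le_d orbT.
  apply/asbool_equiv_eq; rewrite divnMDl // modnMDl divn_small // addn0 modn_small //.
  split=> [[_ [_ [/code_inj-> /ord_inj-> //]]]|satx].
  by exists psi, x.
exists z => //; split; last first.
  exists (x0 : 'I__) => /=; first by rewrite -ltnS.
  by rewrite cellP //; apply/asboolP.
move=> a b x; have [{}a <-] := code_surj a; have [{}b <-] := code_surj b.
move=> le_a le_b le_x; rewrite -(inordK (le_x : x < n.+1)); move: (inord x) => {le_x}x.
apply/and4P; split; [|apply/implyP => le_c; apply/eqP..].
- have -> : 0 = code Bot by [].
  by rewrite cellP //; apply/asboolP.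
- have -> : (4 * cantor_pair (code a) (code b)).+2 = code (Imp a b) by [].
  rewrite !cellP //=; exact: asbool_imply.
- rewrite addn3 -[(4 * _).+3]/(code (Box a)) in le_c *.
  rewrite !cellP //; apply/asboolP/allP => [H y|H y xy].
    rewrite mem_iota => le_y; rewrite -(inordK (le_y : y < n.+1)) cellP //.
    by apply/implyP => /H/asboolP.
  have := H y; rewrite mem_iota cellP // => /(_ (ltn_ord y))/implyP/(_ xy).
  by move/asboolP.
- rewrite addn4 -[(4 * _).+4]/(code (PDia a)) in le_c *.
  rewrite !cellP //; apply/asboolP/hasP => [[y yx saty]|[y]].
    exists (nat_of_ord y); first by rewrite mem_iota ltn_ord.
    by rewrite cellP // yx; apply/asboolP.
  rewrite mem_iota => le_y; rewrite -(inordK (le_y : y < n.+1)) cellP //.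
  by case/andP => yx /asboolP; exists (inord y).
Qed.

(** * Small refuting frames *)

Lemma finite_max (T : finType) (R : T -> T -> Prop) (P : T -> Prop) :
  (forall x y z, R x y -> R y z -> R x z) -> (forall x y, R x y \/ R y x) ->
  (exists x, P x) -> exists y, P y /\ forall x, P x -> R x y.
Proof.
move=> Rtr Rtot [x0 Px0].
suff [y Py ymax] : exists2 y, P y & forall x, x \in enum T -> P x -> R x y.
  by exists y; split=> // x; apply: ymax; rewrite mem_enum.
elim: (enum T) => [|z s [y Py ymax]]; first by exists x0.
have [Pz|nPz] := pselect (P z); last first.
  by exists y => // x; rewrite inE => /orP[/eqP->|/ymax].
have [zy|yz] := Rtot z y.
  by exists y => // x; rewrite inE => /orP[/eqP->|/ymax].
exists z => // x; rewrite inE => /orP[/eqP-> _|xs /(ymax _ xs)/Rtr]; last exact.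
by have [] := Rtot z z.
Qed.

Lemma zacc_trans s l r n : transitive (zacc s l r n).
Proof. by move=> y x z; rewrite /zacc; case: s => /=; lia. Qed.

Lemma zacc_total s l r n x y : zacc s l r n x y || zacc s l r n y x.
Proof. by rewrite /zacc; case: s => /=; lia. Qed.

(** As [l] and [r] are at most 1, only the two end worlds can be set apart, so deleting an inner
    world [y] and renumbering keeps the shape. *)
Lemma zacc_bump s l r n x y z : l <= 1 -> r <= 1 -> 0 < y <= n -> x <= n -> z <= n ->
  zacc s l r n.+1 (bump y x) (bump y z) = zacc s l r n x z.
Proof. rewrite /zacc /bump; case: s => /=; lia. Qed.

(* A subset containing, for every Box (PDia) subformula, a maximal refuting
   (minimal satisfying) world carries a submodel with the same truth values, so
   any other world can be deleted. *)
Lemma refuted_pred s l r n phi : l <= 1 -> r <= 1 -> code phi + 3 <= n ->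
  refuted (zframe s l r n.+1) phi -> refuted (zframe s l r n) phi.
Proof.
move=> l1 r1 le_c /refutedP[V [x0 nsat]]; apply/refutedP; set c := code phi in le_c *.
pose F := zframe s l r n.+1; pose R : 'I_n.+2 -> 'I_n.+2 -> Prop := @acc F.
have Rtr x y z : R x y -> R y z -> R x z by exact: zacc_trans.
have Rtot x y : R x y \/ R y x by apply/orP; exact: zacc_total.
have wit (d : 'I_c.+1) : exists w : 'I_n.+2, forall a,
    (code (Box a) = d -> (exists x : F, ~ sat V x a) ->
       ~ sat (F := F) V w a /\ forall x : F, ~ sat V x a -> R x w) /\
    (code (PDia a) = d -> (exists x : F, sat V x a) ->
       sat (F := F) V w a /\ forall x : F, sat V x a -> R w x).
  have [psi <-] := code_surj d.
  case: psi => [p||a b|a|a].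
  1-3: by exists ord0 => a'; split=> /(@code_inj (_ _)).
  - have [ex|nex] := pselect (exists x : F, ~ sat V x a); last first.
      by exists ord0 => a'; split=> /(@code_inj (_ _)) // -[->].
    have [w wP] := @finite_max 'I_n.+2 R (fun x => ~ sat (F := F) V x a) Rtr Rtot ex.
    by exists w => a'; split=> /(@code_inj (_ _)) // -[->].
  have [ex|nex] := pselect (exists x : F, sat V x a); last first.
    by exists ord0 => a'; split=> /(@code_inj (_ _)) // -[->].
  have [||w wP] := @finite_max 'I_n.+2 (fun x y => R y x) (fun x => sat (F := F) V x a) _ _ ex.
  - by move=> x y z xy yz; exact: Rtr yz xy.
  - by move=> x y; exact: Rtot.
  by exists w => a'; split=> /(@code_inj (_ _)) // -[->].
have {wit}[w wP] := fin_all_exists wit.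
(* At most [c + 4] worlds must stay: both ends, the refuting world and one witness per code up to
   [c]. There are [n + 2] worlds, so some [y] can be deleted. *)
pose S := [:: ord0, ord_max, x0 & codom w].
have /subsetPn[y _] : ~~ ('I_n.+2 \subset S).
  apply: contraTN isT => /subset_leq_card/leq_trans/(_ (card_size _)).
  by rewrite card_ord /= size_codom card_ord; lia.
rewrite !inE !negb_or => /and4P[y0 ymax yx0 yw].
have wy d : w d != y by apply: contraNneq yw => <-; exact: codom_f.
have Rlift (u v : 'I_n.+1) : R (lift y u) (lift y v) <-> zacc s l r n u v.
  rewrite -(@zacc_bump s l r n u y v) //.
  - by move: y0 ymax; rewrite -!val_eqE /=; have := ltn_ord y; lia.
  - by rewrite -ltnS.
  - by rewrite -ltnS.
have liftX x : x != y -> exists u, x = lift y u.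
  by rewrite eq_sym => /unlift_some[u -> _]; exists u.
pose V' p (u : zframe s l r n) := V p (lift y u).
suff satE psi : code psi <= c -> forall u : 'I_n.+1,
    sat (F := zframe s l r n) V' u psi <-> sat (F := F) V (lift y u) psi.
  have [|u Eu] := liftX x0; first by rewrite eq_sym.
  by exists V', u => /(satE _ (leqnn _)); rewrite -Eu.
elim: psi => [p||a IHa b IHb|a IHa|a IHa] le_d u //.
- have [lea leb] := cantor_pair_ge (code a) (code b); rewrite /= in le_d.
  by rewrite /= IHa ?IHb //; lia.
- have le_a : code a <= c by rewrite /= in le_d; lia.
  rewrite /=; split=> H v uv; last by apply/(IHa le_a)/H/Rlift.
  apply: contrapT => nav.
  have [] := (wP (Ordinal (le_d : code (Box a) < c.+1)) a).1 erefl; first by exists v.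
  (* The witness comes after the refuting world [v], hence is seen from [lift y u], and it survives
     the deletion. *)
  move=> nw wmax; apply: nw; have [v' Ev'] := liftX _ (wy (Ordinal (le_d : code (Box a) < c.+1))).
  rewrite Ev'; apply/(IHa le_a)/H/Rlift; rewrite -Ev'.
  exact: (Rtr (lift y u) v _ uv (wmax _ nav)).
- have le_a : code a <= c by rewrite /= in le_d; lia.
  rewrite /=; split=> [[v vu] /(IHa le_a) av|[v vu av]].
    by exists (lift y v) => //; apply/Rlift.
  have [] := (wP (Ordinal (le_d : code (PDia a) < c.+1)) a).2 erefl; first by exists v.
  have [v' Ev'] := liftX _ (wy (Ordinal (le_d : code (PDia a) < c.+1))).
  rewrite Ev' => /(IHa le_a) av' wmin; exists v' => //.
  by apply/Rlift; exact: (Rtr _ v (lift y u) (wmin _ av) vu).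
Qed.

(** * The decision procedure *)

Definition families : seq (bool * nat * nat) :=
  [:: (false, 0, 0); (true, 0, 0); (true, 0, 1); (true, 1, 0); (true, 1, 1)].

(** By [refuted_pred] a refuting frame can be shrunk until [n] is at most the code plus 3, whence
    the search bound. *)
Definition tfamily (k : bool * nat * nat) :=
  let: (s, l, r) := k in
  tex (tadd (tconst 4) (TVar 0))
    (tmul (tle (tconst 2) (TVar 0)) (TApp (trefutes s l r) (TVar 0) (TVar 1))).

(** The last factor is validity in the one-world frame, which expresses consistency because every
    frame collapses onto a single reflexive world. *)
Definition tdecide :=
  foldr (fun k t => tmul (tfamily k) t)
    (tnot (TApp (trefutes false 0 0) TZero (TVar 0))) families.

(** The bound [2 <= n] leaves room for a first world, a last world and a cluster between them. *)
Definition refuted_family (k : bool * nat * nat) phi :=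
  let: (s, l, r) := k in exists2 n, 2 <= n & refuted (zframe s l r n) phi.

Lemma holds_family k phi : k \in families ->
  holds (tfamily k) [:: code phi] <-> refuted_family k phi.
Proof.
case: k => -[s l] r; move=> kF; have [l1 r1] : l <= 1 /\ r <= 1.
  by move: kF; rewrite !inE => /or4P[|||/orP[]]/eqP[_ -> ->].
rewrite /tfamily holds_ex eval_add eval_const; split.
  case/hasP => n _; rewrite holds_mul holds_le => /andP[n2 /holds_refutes nval].
  by exists n.
case=> n; elim: n => // n IHn n2 nval; have [le_n|lt_n] := leqP (code phi + 3) n.
  by apply: IHn; [lia|exact: refuted_pred nval].
apply/hasP; exists n.+1; first by rewrite mem_iota /=; lia.
rewrite holds_mul holds_le eval_const n2; exact/holds_refutes.
Qed.

Lemma decide_spec phi :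
  (holds tdecide [:: code phi]) <->
  valid (zframe false 0 0 0) phi /\ (forall k, k \in families -> refuted_family k phi).
Proof.
have -> : holds tdecide [:: code phi] =
    all (fun k => holds (tfamily k) [:: code phi]) families &&
    ~~ holds (trefutes false 0 0) [:: 0; code phi].
  rewrite /tdecide; elim: families => [|k ks IH]; first exact: holds_not.
  by rewrite /= -andbA -IH; exact: holds_mul.
split=> [/andP[/allP fams /negP one]|[one fams]].
  split=> [|k kF]; last by apply/holds_family/fams.
  by apply: contrapT => /holds_refutes.
apply/andP; split; last by apply/negP => /holds_refutes; exact.
by apply/allP => k kF; apply/holds_family/fams.
Qed.

(** * Canonical models *)

Definition Neg a := Imp a Bot.

Ltac logic_tautology HL :=
  let v := fresh "v" in
  apply: (tl_taut HL) => v /=;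
  repeat match goal with
  | |- context [prop_eval v ?a] => case: (prop_eval v a)
  | |- context [v ?a] => case: (v a)
  end; by [].

Section Canonical.
Variable L : formula -> Prop.
Hypotheses (HL : tense_logic L) (LS : forall chi, S43t chi -> L chi).

Definition theory (T : formula -> Prop) : Prop :=
  (forall a, L a -> T a) /\ (forall a b, T (Imp a b) -> T a -> T b).

Definition mcs (w : formula -> Prop) : Prop :=
  [/\ forall a, L a -> w a, forall a b, w (Imp a b) <-> (w a -> w b) & ~ w Bot].

Lemma theory_ext T a : theory T -> theory (fun b => T (Imp a b)).
Proof.
case=> TL TM; split=> [b Lb|b c Tabc Tab].
  by apply: (TM) (TL _ Lb); apply: TL; logic_tautology HL.
by apply: (TM) Tab; apply: (TM) Tabc; apply: TL; logic_tautology HL.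
Qed.

(** The coding enumerates the formulas: stage [n + 1] adds the formula coded by [n], if there is
    one, unless [psi] would become derivable. Adding [a] to a theory means passing to the [b] with
    [Imp a b] in it. *)
Fixpoint lindenbaum (psi : formula) (T : formula -> Prop) (n : nat) : formula -> Prop :=
  if n is n.+1 then
    let T' := lindenbaum psi T n in
    fun b => T' b \/ exists a, [/\ code a = n, ~ T' (Imp a psi) & T' (Imp a b)]
  else T.

Lemma lindenbaumP T psi : theory T -> ~ T psi ->
  exists w, [/\ mcs w, forall a, T a -> w a & ~ w psi].
Proof.
move=> thT nT; pose U := lindenbaum psi T.
have UP n : theory (U n) /\ ~ U n psi.
  elim: n => // n [thU nU] /=; have [UL UM] := thU.
  have [[a [Ea na]]|nex] := pselect (exists a, code a = n /\ ~ U n (Imp a psi)); last first.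
    suff -> : U n.+1 = U n by [].
    apply/funext => b; apply/propext; split=> [[//|[a [Ea na _]]]|]; last by left.
    by case: nex; exists a.
  suff -> : U n.+1 = fun b => U n (Imp a b) by split=> //; exact: theory_ext.
  apply/funext => b; apply/propext; split=> [[Ub|[a' [Ea' _]]]|Uab].
  - by apply: (UM) Ub; apply: UL; logic_tautology HL.
  - by rewrite -Ea in Ea'; rewrite (code_inj Ea').
  - by right; exists a.
have mono m n b : m <= n -> U m b -> U n b.
  elim: n => [|n IHn]; first by rewrite leqn0 => /eqP->.
  by rewrite leq_eqVlt => /orP[/eqP->//|/IHn H /H]; left.
pose w b := exists n, U n b.
have wL a : L a -> w a by exists 0; apply: thT.1.
have wM a b : w (Imp a b) -> w a -> w b.
  move=> [m Um] [n Un]; exists (maxn m n).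
  have [[_ UM] _] := UP (maxn m n).
  by apply: UM; [apply: (mono) Um|apply: (mono) Un]; rewrite ?leq_maxl ?leq_maxr.
have nw : ~ w psi by case=> n; case: (UP n).
have max a : w a \/ w (Imp a psi).
  have [?|nU] := pselect (U (code a) (Imp a psi)); first by right; exists (code a).
  left; exists (code a).+1; right; exists a; split=> //.
  by have [[UL _] _] := UP (code a); apply: UL; logic_tautology HL.
(* Otherwise [Imp (Imp psi b) psi] lies in [w], and Peirce's law yields [psi]. Thus [psi] behaves as
   falsity in [w]. *)
have psib b : w (Imp psi b).
  have [//|H] := max (Imp psi b); case: nw; apply: (wM) H; apply: wL.
  by logic_tautology HL.
exists w; split=> //; last by exists 0.
split=> // [a b|wB]; last by apply: nw; apply: (wM) wB; apply: wL; logic_tautology HL.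
split=> [|wab]; first exact: wM.
have [/wab wb|wa] := max a; first by apply: (wM) wb; apply: wL; logic_tautology HL.
by apply: (wM) wa; apply: (wM) (psib b); apply: wL; logic_tautology HL.
Qed.

Lemma mcs_neg w a : mcs w -> w (Neg a) <-> ~ w a.
Proof. by case=> _ wI wB; rewrite wI; split=> // nwa /nwa. Qed.

Definition canR (w u : formula -> Prop) := forall a, w (Box a) -> u a.

Lemma logic_box_dia a : L (Imp a (Box (PDia a))).
Proof. by apply/(tl_adj HL); logic_tautology HL. Qed.

Lemma logic_dia_box a : L (Imp (PDia (Box a)) a).
Proof. by apply/(tl_adj HL); logic_tautology HL. Qed.

Lemma logic_imp_trans a b c : L (Imp a b) -> L (Imp b c) -> L (Imp a c).
Proof.
move=> ab bc; apply: (tl_mp HL) ab; apply: (tl_mp HL) bc; by logic_tautology HL.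
Qed.

Lemma logic_dia_mono a b : L (Imp a b) -> L (Imp (PDia a) (PDia b)).
Proof. by move=> ab; apply/(tl_adj HL)/(logic_imp_trans ab)/logic_box_dia. Qed.

Lemma logic_box_mono a b : L (Imp a b) -> L (Imp (Box a) (Box b)).
Proof. by move=> /(tl_nec HL)/(tl_mp HL); apply; exact: tl_K. Qed.

Lemma mcs_mono w a b : mcs w -> L (Imp a b) -> w a -> w b.
Proof. by case=> wL wI _ /wL/wI. Qed.

Lemma canRP w u : mcs w -> mcs u -> canR w u <-> forall a, w a -> u (PDia a).
Proof.
move=> mw mu; split=> [wu a wa|wu a /wu]; first exact/wu/(mcs_mono mw (logic_box_dia a)).
exact/(mcs_mono mu)/logic_dia_box.
Qed.

Lemma can_box w a : mcs w -> ~ w (Box a) ->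
  exists u, [/\ mcs u, canR w u & ~ u a].
Proof.
move=> [wL wI wB] na.
have [||u [mu wu nu]] := @lindenbaumP (fun b => w (Box b)) a.
- split=> [b Lb|b c wbc wb]; first exact/wL/(tl_nec HL).
  by move: wb; apply/wI; move: wbc; apply/wI/wL/(tl_K HL).
- by [].
by exists u.
Qed.

Lemma can_dia w a : mcs w -> w (PDia a) ->
  exists u, [/\ mcs u, canR u w & u a].
Proof.
move=> mw wPa; have [wL wI wB] := mw.
have [||u [mu wu nu]] := @lindenbaumP (fun b => ~ w (PDia (Neg b))) (Neg a).
- split=> [b Lb wP|b c nbc nb wc].
    apply: wB; move: wP; apply: (mcs_mono mw); apply/(tl_adj HL).
    by apply: (tl_mp HL) Lb; logic_tautology HL.
  (* [Neg c] entails the disjunction of [Neg (Imp b c)] and [Neg b], and [PDia], being a left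
     adjoint, distributes over it; the adjunction reduces this to a goal under [Box]. *)
  have : w (Imp (Neg (PDia (Neg (Imp b c)))) (PDia (Neg b))).
    move: wc; apply: (mcs_mono mw); apply/(tl_adj HL).
    pose X := Imp (Neg (PDia (Neg (Imp b c)))) (PDia (Neg b)).
    have H1 : L (Imp (Neg (Imp b c)) (Box X)).
      apply: logic_imp_trans (logic_box_dia _) _; apply: logic_box_mono.
      by rewrite /X; logic_tautology HL.
    have H2 : L (Imp (Neg b) (Box X)).
      apply: logic_imp_trans (logic_box_dia _) _; apply: logic_box_mono.
      by rewrite /X; logic_tautology HL.
    by apply: (tl_mp HL) H1; apply: (tl_mp HL) H2; logic_tautology HL.
  by move/wI => H; apply/nb/H/(mcs_neg _ mw).
- apply; move: wPa; apply: (mcs_mono mw); apply: logic_dia_mono; logic_tautology HL.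
exists u; split=> //; last by apply: contrapT => nua; apply/nu/mcs_neg.
apply/canRP => // b ub; apply: contrapT => nwb.
suff : u (Neg b) by move/(mcs_neg _ mu).
apply: wu => H; apply: nwb; move: H; apply: (mcs_mono mw); apply: logic_dia_mono.
by logic_tautology HL.
Qed.

Lemma can_refl w : mcs w -> canR w w.
Proof.
move=> mw a; apply: (mcs_mono mw); apply: LS => F [rF _ _] V x /=; exact.
Qed.

Lemma can_trans w u v : mcs w -> canR w u -> canR u v -> canR w v.
Proof.
move=> mw wu uv a wa; apply/uv/wu; move: wa; apply: (mcs_mono mw); apply: LS.
by move=> F [_ tF _] V x /= H y xy z yz; apply/H/(tF _ y).
Qed.

Lemma can_sep w u : ~ canR w u -> exists2 a, w (Box a) & ~ u a.
Proof.
move=> nwu; apply: contrapT => H; apply: nwu => a wa; apply: contrapT => na.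
by apply: H; exists a.
Qed.

Lemma can_lin_up x w u : mcs x -> mcs w -> mcs u -> canR x w -> canR x u ->
  canR w u \/ canR u w.
Proof.
move=> mx mw mu xw xu; apply: contrapT => /not_orP[/can_sep[a wa na] /can_sep[b ub nb]].
have [_ wI _] := mw; have [_ uI _] := mu; have [xL xI _] := mx.
(* The connectedness axiom: one of [Box (Imp (Box a) b)] and [Box (Imp (Box b) a)] holds on linear
   frames. *)
have : x (Imp (Neg (Box (Imp (Box a) b))) (Box (Imp (Box b) a))).
  apply/xL/LS => F [_ tF lF] V y /= nab z yz zb; apply: contrapT => nza.
  apply: nab => t yt ta; have [tz|zt] := lF t z; first by case: nza; exact: ta.
  exact: zb.
move/xI => H; apply: na.
suff : u (Imp (Box b) a) by move/uI; apply.
by apply: xu; apply: H; apply/(mcs_neg _ mx) => /xw /wI/(_ wa).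
Qed.

Lemma can_lin_down x w u : mcs x -> mcs w -> mcs u -> canR w x -> canR u x ->
  canR w u \/ canR u w.
Proof.
move=> mx mw mu wx ux; apply: contrapT => /not_orP[/can_sep[a wa na] /can_sep[b ub nb]].
have [xL xI _] := mx.
(* The past mirror of that axiom: [Imp (Box a) b] and [Imp (Box b) a] cannot both fail in the
   past. *)
have : x (Imp (PDia (Neg (Imp (Box a) b))) (Neg (PDia (Neg (Imp (Box b) a))))).
  apply/xL/LS => F [_ tF lF] V y /= [z zy nz] [t ty nt].
  have [tz|zt] := lF t z.
    by apply: nz => za; apply: contrapT => nzb; apply: nt => tb; case: nzb; exact: tb.
  by apply: nt => tb; apply: contrapT => nta; apply: nz => za; case: nta; exact: za.
move/xI => H.
have inP y c d : mcs y -> canR y x -> y c -> ~ y d -> x (PDia (Neg (Imp c d))).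
  move=> my /(canRP my mx) + yc nd; apply; apply/(mcs_neg _ my).
  by have [_ yI _] := my; move/yI/(_ yc).
have /H/(mcs_neg _ mx) := inP _ _ _ mw wx wa nb; apply.
exact: (inP _ _ _ mu ux ub na).
Qed.

End Canonical.

Record canonical_model (L : formula -> Prop) (W : frame)
    (m : W -> formula -> Prop) : Prop := CanonicalModel {
  cm_refl : reflexive_frame W;
  cm_trans : transitive_frame W;
  cm_lin : linear_frame W;
  cm_mcs : forall w, mcs L (m w);
  cm_box : forall w a, m w (Box a) <-> forall u, acc w u -> m u a;
  cm_dia : forall w a, m w (PDia a) <-> exists2 u, acc u w & m u a;
  cm_tight : forall w u, ~ acc w u -> exists2 a, m w (Box a) & ~ m u a;
  cm_inj : forall w u, w <> u -> exists2 a, m w a & ~ m u a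
}.

Lemma canonical_modelP L psi :
  tense_logic L -> (forall chi, S43t chi -> L chi) -> ~ L psi ->
  exists (W : frame) (m : W -> formula -> Prop),
    canonical_model L m /\ exists w, ~ m w psi.
Proof.
move=> HL LS nL.
have [|//|x [mx _ nx]] := @lindenbaumP L HL L psi.
  by split=> // a b; exact: tl_mp.
have Rxx := can_refl LS mx.
(* As there is no branching in either direction, the worlds comparable with [x] are closed under
   successors and predecessors and form a linear frame. *)
pose comp u := mcs L u /\ (canR x u \/ canR u x).
pose W := @Frame {u | comp u} (fun u v => canR (sval u) (sval v))
  (inhabits (exist comp x (conj mx (or_introl Rxx)))).
have mW (u : W) : mcs L (sval u) by case: (svalP u).
have linW : linear_frame W.
  move=> u v; case: (svalP u) (svalP v) => mu [xu|ux] [mv [xv|vx]].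
  - exact: (can_lin_up LS mx).
  - right; exact: (can_trans LS mv vx xu).
  - left; exact: (can_trans LS mu ux xv).
  - exact: (can_lin_down HL LS mx).
have up (u : W) v : mcs L v -> canR (sval u) v -> comp v.
  move=> mv uv; split=> //; case: (svalP u) => mu [xu|ux].
    by left; exact: (can_trans LS mx xu uv).
  by apply: (can_lin_up LS mu).
have down (u : W) v : mcs L v -> canR v (sval u) -> comp v.
  move=> mv vu; split=> //; case: (svalP u) => mu [xu|ux].
    exact: (can_lin_down HL LS mu).
  by right; exact: (can_trans LS mv vu ux).
exists W, (fun u => sval u); split; last first.
  by exists (exist comp x (conj mx (or_introl Rxx))).
split=> //.
- by move=> u; exact: (can_refl LS (mW u)).
- by move=> u v t uv vt; exact: (can_trans LS (mW u) uv vt).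
- move=> u a; split=> [ua v uv|H]; first exact: uv.
  apply: contrapT => /(can_box HL (mW u))[v [mv uv nv]].
  exact/nv/(H (exist comp v (up u v mv uv))).
- move=> u a; split=> [/(can_dia HL (mW u))[v [mv vu va]]|[v vu va]].
    by exists (exist comp v (down u v mv vu)).
  by move/(canRP HL (mW v) (mW u)): vu; apply.
- by move=> u v; exact: can_sep.
- move=> u v nuv; apply: contrapT => H; apply: nuv.
  suff Euv : sval u = sval v.
    by move: u v Euv {H} => [u pu] [v pv] /= Euv; move: pu pv; rewrite Euv => pu pv;
      congr exist; exact: Prop_irrelevance.
  apply/funext => a; apply/propext.
  have sub b : sval u b -> sval v b.
    by move=> ub; apply: contrapT => nvb; apply: H; exists b.
  split=> [/sub//|va]; apply: contrapT => nua.
  have /sub/(mcs_neg _ (mW v)) : sval u (Neg a) by apply/(mcs_neg _ (mW u)).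
  exact.
Qed.

(** * Definable bounded morphisms *)

Definition bounded_morphism (W F : frame) (h : W -> F) : Prop :=
  [/\ forall w u, acc w u -> acc (h w) (h u),
      forall w q, acc (h w) q -> exists2 u, acc w u & h u = q &
      forall w q, acc q (h w) -> exists2 u, acc u w & h u = q].

Lemma sat_morphism (W F : frame) (h : W -> F) V chi w : bounded_morphism h ->
  sat (fun n u => V n (h u)) w chi <-> sat V (h w) chi.
Proof.
case=> hom fwd bwd; elim: chi w => [p||a IHa b IHb|a IHa|a IHa] w //=.
- by rewrite IHa IHb.
- split=> H; first by move=> q /fwd[u wu <-]; apply/IHa/H.
  by move=> u /hom/H/IHa.
- split=> [[u /hom uw /IHa au]|[q /bwd[u uw <-] /IHa au]]; last by exists u.
  by exists (h u).
Qed.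

Definition definable (W : Type) (m : W -> formula -> Prop) (A : W -> Prop) : Prop :=
  exists chi, forall w, A w <-> m w chi.

Section Model.
Variables (L : formula -> Prop) (W : frame) (m : W -> formula -> Prop).
Hypotheses (HL : tense_logic L) (CM : canonical_model L m).

(** * Definable sets and transfer along definable morphisms *)

Lemma eq_definable (A B : W -> Prop) :
  (forall w, A w <-> B w) -> definable m A -> definable m B.
Proof. by move=> AB [chi Achi]; exists chi => w; rewrite -AB. Qed.

Lemma definable_imp (A B : W -> Prop) : definable m A -> definable m B ->
  definable m (fun w => A w -> B w).
Proof.
move=> [a Aa] [b Bb]; exists (Imp a b) => w.
by have [_ -> _] := cm_mcs CM w; rewrite Aa Bb.
Qed.

Lemma definable_false : definable m (fun=> False).
Proof. by exists Bot => w; have [_ _ nB] := cm_mcs CM w. Qed.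

Lemma definable_not (A : W -> Prop) : definable m A -> definable m (fun w => ~ A w).
Proof. move=> dA; exact: definable_imp dA definable_false. Qed.

Lemma definable_true : definable m (fun=> True).
Proof. by apply: eq_definable (definable_not definable_false) => w; split=> // _ []. Qed.

Lemma definable_or (A B : W -> Prop) : definable m A -> definable m B ->
  definable m (fun w => A w \/ B w).
Proof.
move=> dA dB; apply: eq_definable (definable_imp (definable_not dA) dB) => w.
split=> [H|[? []//|//]]; have [?|/H] := pselect (A w); by [left|right].
Qed.

Lemma definable_and (A B : W -> Prop) : definable m A -> definable m B ->
  definable m (fun w => A w /\ B w).
Proof.
move=> dA dB.
apply: eq_definable (definable_not (definable_imp dA (definable_not dB))) => w.
split=> [H|[? ?] H]; last exact: H.
by apply: contrapT => nAB; apply: H => a b; apply: nAB.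
Qed.

Lemma definable_const (P : Prop) : definable m (fun=> P).
Proof.
have [p|np] := pselect P.
  by apply: eq_definable definable_true => w; split.
by apply: eq_definable definable_false => w; split.
Qed.

Lemma definable_preim (T : finType) (h : W -> T) (P : T -> Prop) :
  (forall t, definable m (fun w => h w = t)) -> definable m (fun w => P (h w)).
Proof.
move=> dh.
suff dS (s : seq T) : definable m (fun w => exists2 t, t \in s & P t /\ h w = t).
  apply: (eq_definable _ (dS (enum T))) => w; split=> [[t _ [Pt ->]] //|Pw].
  by exists (h w); rewrite ?mem_enum.
elim: s => [|t s IHs].
  by apply: eq_definable definable_false => w; split=> // -[].
apply: eq_definable (definable_or (definable_and (definable_const (P t)) (dh t)) IHs) => w.
split=> [[Pt|[u us Pu]]|[u]].
- by exists t => //; rewrite mem_head.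
- by exists u => //; rewrite inE us orbT.
- by rewrite inE => /orP[/eqP->|us Pu]; [left|right; exists u].
Qed.

Lemma truth s chi w : sat (fun n u => m u (s n)) w chi <-> m w (subst s chi).
Proof.
elim: chi w => [p||a IHa b IHb|a IHa|a IHa] w //=.
- by have [_ _ nB] := cm_mcs CM w.
- by have [_ -> _] := cm_mcs CM w; rewrite IHa IHb.
- by rewrite (cm_box CM); split=> H u /H/IHa.
- by rewrite (cm_dia CM); split=> -[u uw /IHa]; exists u.
Qed.

(** Definable fibers make each pulled-back [V n] the truth set of a formula [s n], so pulling back
    the valuation amounts to substituting [s]. *)
Lemma definable_transfer (T : finType) (R : T -> T -> Prop) (T0 : inhabited T)
    (h : W -> Frame R T0) (V : nat -> T -> Prop) :
  bounded_morphism h -> (forall t : T, definable m (fun w => h w = t)) ->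
  exists s, forall w chi, sat (F := Frame R T0) V (h w) chi <-> m w (subst s chi).
Proof.
move=> hh dh; have [s sP] := choice (fun n => definable_preim (V n) dh).
exists s => w chi; rewrite -(@sat_morphism W (Frame R T0) h V chi w hh) -truth.
suff -> : (fun n u => V n (h u)) = (fun n u => m u (s n)) by [].
by apply/funext => n; apply/funext => u; apply/propext.
Qed.

Lemma no_morphism (T : finType) (R : T -> T -> Prop) (T0 : inhabited T)
    (h : W -> Frame R T0) phi :
  L phi -> refuted (Frame R T0) phi ->
  bounded_morphism h -> (forall t : T, definable m (fun w => h w = t)) ->
  (forall t, exists w, h w = t) -> False.
Proof.
move=> Lphi /refutedP[V [t nsat]] hh dh hsurj.
have [s sP] := definable_transfer V hh dh; have [w Ew] := hsurj t.
rewrite -Ew in nsat; apply/nsat/sP; have [wL _ _] := cm_mcs CM w.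
exact/wL/(tl_subst HL).
Qed.

(** By linearity, a definable bounded morphism onto the chain of [n + 1] worlds, presented through
    its definable up-sets. *)
Definition ranking (n : nat) (f : W -> nat) : Prop :=
  [/\ forall w, f w <= n, forall i, i <= n -> exists w, f w = i,
      forall w u, acc w u -> f w <= f u & forall i, definable m (fun w => i <= f w)].

Lemma ranking_fiber n f i : ranking n f -> definable m (fun w => f w = i).
Proof.
case=> _ _ _ df.
apply: eq_definable (definable_and (df i) (definable_not (df i.+1))) => w.
by split; lia.
Qed.

Lemma ranking_lt n f w u : ranking n f -> f w < f u -> acc w u.
Proof. by case=> _ _ fmono _; have [//|/fmono] := cm_lin CM w u; lia. Qed.

Lemma no_ranking n phi f :
  L phi -> refuted (zframe false 0 0 n) phi -> ranking n f -> False.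
Proof.
move=> Lphi nval rf; have [fn fsurj fmono df] := rf.
pose h w : zframe false 0 0 n := inord (f w) : 'I_n.+1.
have hE w : nat_of_ord (h w) = f w by rewrite inordK // ltnS.
apply: (no_morphism (h := h)) Lphi nval _ _ _.
- split=> [w u /fmono|w q|w q].
  + by rewrite /= /zacc !hE => ->.
  + rewrite /= /zacc orbF hE => le_wq; have [u Eu] := fsurj q (ltn_ord q).
    have Euq : h u = q by apply/val_inj; rewrite /= hE.
    have [Ewq|ne] := eqVneq (f w) q.
      by exists w; [exact: (cm_refl CM)|apply/val_inj; rewrite /= hE].
    by exists u => //; apply: (ranking_lt rf); rewrite Eu ltn_neqAle ne.
  + rewrite /= /zacc orbF hE => le_qw; have [u Eu] := fsurj q (ltn_ord q).
    have Euq : h u = q by apply/val_inj; rewrite /= hE.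
    have [Ewq|ne] := eqVneq (q : nat) (f w).
      by exists w; [exact: (cm_refl CM)|apply/val_inj; rewrite /= hE].
    by exists u => //; apply: (ranking_lt rf); rewrite Eu ltn_neqAle ne.
- move=> t; apply: eq_definable (ranking_fiber t rf) => w.
  by split=> [Ew|<-]; [apply/val_inj; rewrite /= hE|rewrite hE].
- move=> t; have [w Ew] := fsurj t (ltn_ord t).
  by exists w; apply/val_inj; rewrite /= hE.
Qed.

Lemma max_exists (Q : nat -> Prop) n : Q 0 -> ~ Q n -> exists k, [/\ k < n, Q k & ~ Q k.+1].
Proof.
elim: n => [//|n IHn] Q0 nQ; have [Qn|nQn] := pselect (Q n); first by exists n.
by have [k [lt_k Qk nQk]] := IHn Q0 nQn; exists k; split=> //; exact: leqW.
Qed.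

(** A [Box] formula true at [x] and not at [y] defines an up-set [U]. Raising by one the worlds of
    rank above [j] and those of rank [j] in [U] splits level [j] in two. *)
Lemma rankingS n f x y : ranking n f -> f x = f y -> ~ acc x y ->
  exists g, ranking n.+1 g.
Proof.
move=> [fn fsurj fmono df] Exy /(cm_tight CM)[a xa nya]; set j := f x in Exy.
pose U w := m w (Box a).
have Umono w u : acc w u -> U w -> U u.
  move=> wu /(cm_box CM) H; apply/(cm_box CM) => v uv; apply: H.
  exact: (cm_trans CM) wu uv.
have nUy : ~ U y by move=> /(cm_box CM)/(_ _ (cm_refl CM y)).
pose D w := `[< j < f w \/ j = f w /\ U w >].
have Dmono w u : acc w u -> D w -> D u.
  move=> wu /asboolP H; apply/asboolP; have le_f := fmono _ _ wu.
  case: H => [lt_j|[Ej Uw]]; first by left; lia.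
  by have [lt|] := ltnP j (f u); [left|right; split; [lia|exact: Umono Uw]].
have Dlt w : f w < j -> D w = false by move=> lt; apply/negP => /asboolP; lia.
have Dgt w : j < f w -> D w by move=> lt; apply/asboolP; left.
exists (fun w => f w + D w); split=> [w|i le_i|w u wu|i].
- by have := fn w; case: (D w); lia.
- have [lt_ij|gt_ij|->] := ltngtP i j.
  + have [|w Ew] := fsurj i; first by have := fn x; lia.
    by exists w; rewrite Dlt Ew // addn0.
  + have [Ei|ne] := eqVneq i j.+1.
      exists x; suff -> : D x = true by rewrite Ei addn1.
      by apply/asboolP; right.
    have [|w Ew] := fsurj i.-1; first by lia.
    by exists w; rewrite Dgt ?Ew; lia.
  + exists y; suff -> : D y = false by rewrite -Exy addn0.
    by apply/negP => /asboolP; rewrite -Exy => -[|[_ //]]; rewrite ltnn.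
- apply: leq_add; first exact: fmono.
  by have := Dmono w u wu; case: (D w) => // ->.
- have dD : definable m (fun w => D w).
    have dU : definable m U by exists (Box a).
    apply: eq_definable (definable_or (df j.+1) (definable_and (definable_and
      (df j) (definable_not (df j.+1))) dU)) => w.
    split=> [H|/asboolP H]; first apply/asboolP; case: H => [lt|[H Uw]];
      by [left|right; split=> //; lia].
  apply: eq_definable (definable_or (df i) (definable_and (df i.-1) dD)) => w.
  split=> [[|[+ ->]]|]; [lia|lia|].
  by case: (D w) => H; [|left; lia]; have [?|?] := leqP i (f w); [left|right; split=> //; lia].
Qed.

(** A ranking of maximal length admits no refinement, so by [rankingS] its levels are exactly the
    clusters. *)
Lemma max_ranking n phi : L phi -> refuted (zframe false 0 0 n) phi ->
  exists k f, [/\ k < n, ranking k f & forall x y, acc x y <-> f x <= f y].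
Proof.
move=> Lphi nval.
have [||k [lt_k [f rf] nk]] := @max_exists (fun n => exists f, ranking n f) n.
- exists (fun=> 0); split=> // [i|i]; last exact: definable_const.
  by rewrite leqn0 => /eqP->; have [w] := world_inhabited W; exists w.
- by case=> f; exact: no_ranking nval.
exists k, f; split=> // x y; split; first by case: rf => _ _ fm _ /fm.
rewrite leq_eqVlt => /orP[/eqP Exy|]; last exact: ranking_lt rf.
by apply: contrapT => /(rankingS rf Exy).
Qed.

(** * Cutting a cluster into definable pieces *)

Section Cluster.
Variables (k : nat) (f : W -> nat).
Hypotheses (rf : ranking k f) (accE : forall x y, acc x y <-> f x <= f y).

Definition splitting (j n : nat) (g : W -> nat) : Prop :=
  [/\ forall w, g w <= n, forall i, i <= n -> exists w, f w = j /\ g w = i &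
      forall i, definable m (fun w => g w = i)].

(** Clusters before [j] collapse to the first world, those after it to the last, and [g] spreads
    cluster [j] over the middle. [l] and [r] record whether such clusters exist, so the map is
    onto. *)
Lemma no_splitting j n g phi (l := (0 < j : nat)) (r := (j < k : nat)) :
  j <= k ->
  L phi -> refuted (zframe true l r (l + n + r)) phi -> splitting j n g -> False.
Proof.
move=> le_j Lphi nval [gn gsurj dg]; have [fn fsurj _ df] := rf.
set N := l + n + r in nval.
pose h' w := if f w < j then 0 else if j < f w then N else l + g w.
have lP : 0 < j /\ l = 1 \/ j = 0 /\ l = 0 by rewrite /l; case: (posnP j); [right|left].
have rP : j < k /\ r = 1 \/ j = k /\ r = 0 by rewrite /r; case: (ltnP j k); [left|right]; lia.
have h'P w : [\/ f w < j /\ h' w = 0, f w = j /\ h' w = l + g w | j < f w /\ h' w = N].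
  by rewrite /h'; case: (ltngtP (f w) j) => H; [exact: Or31|exact: Or33|exact: Or32].
have NE : N = l + n + r by [].
move: l r N h' lP rP h'P NE nval => l r N h' lP rP h'P NE nval.
have h'N w : h' w <= N by have := gn w; case: (h'P w) => -[]; lia.
pose h w : zframe true l r N := inord (h' w) : 'I_N.+1.
have hE w : nat_of_ord (h w) = h' w by rewrite inordK // ltnS.
have hP w (q : 'I_N.+1) : h w = q <-> h' w = q.
  by split=> [<-|E]; [rewrite hE|apply/val_inj; rewrite /= hE].
have surj (q : 'I_N.+1) : exists w, h' w = q /\
    [\/ [/\ q < l & f w < j], [/\ l <= q, q + r <= N & f w = j] | [/\ N < q + r & f w = k]].
  have le_qN : q <= N by rewrite -ltnS.
  have [lt_ql|le_lq] := ltnP q l.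
    have [w Ew] := fsurj 0 isT; exists w; split; last by apply: Or31; split=> //; lia.
    by case: (h'P w) => -[]; lia.
  have [le_q|lt_N] := leqP (q + r) N.
    have [|w [Ew gw]] := gsurj (q - l); first by lia.
    exists w; split; last by apply: Or32.
    by case: (h'P w) => -[]; lia.
  have [w Ew] := fsurj k (leqnn k); exists w; split; last by apply: Or33.
  by case: (h'P w) => -[]; lia.
have zE x y : zacc true l r N x y = (x <= y) || (l <= y) && (x + r <= N) by [].
apply: (no_morphism (h := h)) Lphi nval _ _ _.
- split=> [w u|w q|w q].
  + move/accE => le_wu; rewrite [acc _ _]/= !hE zE.
    have := gn w; have := gn u; have := fn w; have := fn u.
    by case: (h'P w) => -[]; case: (h'P u) => -[]; lia.
  + rewrite [acc _ _]/= !hE zE => wq; have [u [Eu Hu]] := surj q.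
    have [le_wu|lt_uw] := leqP (f w) (f u); first by exists u; [exact/accE|exact/hP].
    (* A chosen preimage [u] can precede [w] although [h w] sees [q] only when [w] is itself sent to
       [q]. *)
    exists w; first exact: (cm_refl CM).
    apply/hP; have := gn w; have := fn w; have := fn u; have := ltn_ord q.
    by case: (h'P w) => -[]; case: Hu => -[]; lia.
  + rewrite [acc _ _]/= !hE zE => wq; have [u [Eu Hu]] := surj q.
    have [le_wu|lt_uw] := leqP (f u) (f w); first by exists u; [exact/accE|exact/hP].
    exists w; first exact: (cm_refl CM).
    apply/hP; have := gn w; have := fn w; have := fn u; have := ltn_ord q.
    by case: (h'P w) => -[]; case: Hu => -[]; lia.
- move=> t; apply: (@eq_definable (fun w => h' w = t)) => [w|]; first by rewrite hP.
  have dlt : definable m (fun w => f w < j).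
    apply: eq_definable (definable_not (df j)) => w; lia.
  have dgt := df j.+1.
  apply: eq_definable (definable_or (definable_and dlt (definable_const (0 = t :> nat)))
    (definable_and (definable_not dlt) (definable_or
      (definable_and dgt (definable_const (N = t :> nat)))
      (definable_and (definable_not dgt) (definable_and (definable_const (l <= t))
         (dg (t - l))))))) => w.
  by case: (h'P w) => -[H1 H2]; lia.
- by move=> q; have [w [Ew _]] := surj q; exists w; apply/hP.
Qed.

(** Take a splitting with the most pieces: were two worlds of the cluster in one piece, a formula
    separating them would cut it further. *)
Lemma max_splitting j n phi (l := (0 < j : nat)) (r := (j < k : nat)) :
  j <= k -> L phi -> refuted (zframe true l r (l + n + r)) phi ->
  exists g, [/\ forall w, g w <= n, forall i, definable m (fun w => g w = i) &
     forall x y, f x = j -> f y = j -> g x = g y -> x = y].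
Proof.
move=> le_j Lphi nval.
have [||i [lt_i [g [gi gsurj dg]] ni]] := @max_exists (fun n => exists g, splitting j n g) n.
- exists (fun=> 0); split=> // [i|i]; last exact: definable_const.
  rewrite leqn0 => /eqP->; have [_ fsurj _ _] := rf.
  by have [w Ew] := fsurj j le_j; exists w.
- by case=> g; exact: no_splitting nval.
exists g; split=> // [w|x y fx fy gxy]; first by have := gi w; lia.
apply: contrapT => /(cm_inj CM)[a xa nya]; apply: ni.
pose E w := `[< g w = g x /\ m w a >].
have Ex : E x by apply/asboolP.
have nEy : E y = false by apply/negP => /asboolP[].
(* The part of the piece containing [x] gets the new value [i + 1]; [y] keeps the old value, so no
   value is lost. *)
exists (fun w => if E w then i.+1 else g w); split=> [w|q|q].
- by case: ifP => // _; exact: leqW.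
- rewrite leq_eqVlt => /orP[/eqP->|lt_q]; first by exists x; rewrite Ex.
  have [Eq|ne] := eqVneq q (g x); first by exists y; rewrite nEy Eq.
  have [w [fw gw]] := gsurj q lt_q; exists w; split=> //; case: ifP => // /asboolP[].
  by rewrite gw => /eqP; rewrite (negPf ne).
- have dE : definable m (fun w => E w).
    have da : definable m (fun w => m w a) by exists a.
    by apply: eq_definable (definable_and (dg (g x)) da) => w; split=> /asboolP.
  apply: eq_definable (definable_or (definable_and dE (definable_const (i.+1 = q)))
    (definable_and (definable_not dE) (dg q))) => w.
  by case: (E w); intuition.
Qed.

End Cluster.

End Model.

(** * Tabularity *)

(** A world is identified by its cluster and its piece within it; both counts are bounded by frames
    refuting [phi], chosen before the logic and the model. *)
Lemma finite_model_bound phi :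
  (forall k, k \in families -> refuted_family k phi) ->
  exists N, forall L (W : frame) (m : W -> formula -> Prop),
    tense_logic L -> L phi -> canonical_model L m ->
    exists h : W -> 'I_N.+1 * 'I_N.+1,
      injective h /\ forall t, definable m (fun w => h w = t).
Proof.
move=> fams.
have [n0 _ nval0] := fams (false, 0, 0) isT.
have [N1 ref] : exists N, forall l r : bool, exists2 n, n <= N &
    refuted (zframe true l r (l + n + r)) phi.
  have ex (b : bool * bool) : exists n, refuted (zframe true b.1 b.2 (b.1 + n + b.2)) phi.
    have [|n n2 nval] := fams (true, nat_of_bool b.1, nat_of_bool b.2).
      by case: b => -[] [].
    (* The subtraction is exact because [2 <= n]. *)
    by exists (n - b.1 - b.2); congr (refuted (zframe _ _ _ _) _): nval; case: b => -[] [] /=; lia.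
  have [n nP] := fin_all_exists ex.
  exists (\max_b n b) => l r; exists (n (l, r)); first exact: leq_bigmax.
  exact: (nP (l, r)).
exists (n0 + N1) => L W m HL Lphi CM.
have [k [f [lt_k rf accE]]] := max_ranking HL CM Lphi nval0.
have ex (j : 'I_k.+1) : exists g, [/\ forall w, g w <= N1,
    forall i, definable m (fun w => g w = i) &
    forall x y, f x = j -> f y = j -> g x = g y -> x = y].
  have le_j : j <= k by rewrite -ltnS.
  have [n le_n nval] := ref (0 < j) (j < k).
  have [g [gn dg ginj]] := max_splitting HL CM rf accE le_j Lphi nval.
  by exists g; split=> // w; exact: leq_trans le_n.
have [g gP] := fin_all_exists ex; have [fk _ _ _] := rf.
pose h w : 'I_(n0 + N1).+1 * 'I_(n0 + N1).+1 :=
  (inord (f w), inord (g (inord (f w)) w)).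
have h1 w : nat_of_ord (h w).1 = f w by rewrite inordK //; have := fk w; lia.
have h2 w : nat_of_ord (h w).2 = g (inord (f w)) w.
  by rewrite inordK //; have [gn _ _] := gP (inord (f w)); have := gn w; lia.
have fE w : nat_of_ord (inord (f w) : 'I_k.+1) = f w by rewrite inordK // ltnS.
exists h; split=> [x y Exy|[s t]].
  have Ef : f x = f y by rewrite -!h1 Exy.
  have [_ _ ginj] := gP (inord (f x)); apply: ginj; rewrite ?fE //.
  by rewrite -h2 Ef -h2 Exy.
have [le_s|lt_s] := leqP s k; last first.
  apply: eq_definable (definable_const CM False) => w; split=> // E.
  by have := h1 w; rewrite E /=; have := fk w; lia.
have [_ dg _] := gP (inord s).
apply: eq_definable (definable_and CM (ranking_fiber CM s rf) (dg t)) => w.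
split=> [[Ef Eg]|E]; last first.
  have Ef : f w = s by rewrite -h1 E.
  by split=> //; rewrite -Ef -h2 E.
congr pair; apply/val_inj; rewrite /= inordK ?Ef ?Eg //; exact: ltn_ord.
Qed.

Lemma subst_Var phi : subst Var phi = phi.
Proof. by elim: phi => //= [a -> b ->|a ->|a ->]. Qed.

Lemma logic_past_nec (L : formula -> Prop) a : tense_logic L -> L a -> L (Neg (PDia (Neg a))).
Proof.
move=> HL La; apply/(tl_adj HL).
by apply: (tl_mp HL) La; logic_tautology HL.
Qed.

(* The graph of the accessibility relation is stored in each world, so that a
   single frame contains a copy of every frame on a subset of I; its worlds at
   which L is valid form a union of connected components. *)
Lemma tabular_finite (I : finType) (L : formula -> Prop) :
  tense_logic L -> (forall chi, S43t chi -> L chi) -> ~ L Bot ->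
  (forall (W : frame) (m : W -> formula -> Prop), canonical_model L m ->
     exists h : W -> I, injective h /\ forall t, definable m (fun w => h w = t)) ->
  tabular L.
Proof.
move=> HL LS cons fin; pose X : finType := ({set I * I} * I)%type.
pose RX (p q : X) := p.1 = q.1 /\ (p.2, q.2) \in p.1.
have [W0 [m0 [CM0 [w0 _]]]] := canonical_modelP HL LS cons.
have [h0 _] := fin _ _ CM0.
pose B := Frame RX (inhabits (set0, h0 w0)).
pose good (p : X) := forall chi, L chi -> forall V, sat (F := B) V p chi.
have emb (W : frame) (m : W -> formula -> Prop) : canonical_model L m ->
    exists h : W -> B, [/\ injective h, bounded_morphism h & forall w, good (h w)].
  move=> CM; have [h [hinj dh]] := fin _ _ CM.
  pose r := [set t : I * I | `[< exists u v, acc u v /\ t = (h u, h v) >]].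
  pose hX w : B := (r, h w).
  have hXinj : injective hX by move=> u v [/hinj].
  have rP u v : (h u, h v) \in r <-> acc u v.
    rewrite inE; split=> [/asboolP[u' [v' [uv [/hinj-> /hinj->]]]] //|uv].
    by apply/asboolP; exists u, v.
  have hXm : bounded_morphism hX.
    split=> [w u wu|w [r' q] [/= <-]|w [r' q] [/= ->]].
    - by split=> //; apply/rP.
    - rewrite inE => /asboolP[u [v [uv [/hinj Ew ->]]]]; subst u; by exists v.
    - rewrite inE => /asboolP[u [v [uv [-> /hinj Ew]]]]; subst v; by exists u.
  have dhX (t : X) : definable m (fun w => hX w = t).
    apply: eq_definable (definable_and CM (definable_const CM (r = t.1)) (dh t.2)) => w.
    by case: t => r' t; rewrite /hX; split=> [[/= -> ->]|[-> ->]].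
  exists hX; split=> // w chi Lchi V.
  have [s sP] := definable_transfer CM V hXm dhX; apply/sP.
  by have [wL _ _] := cm_mcs CM w; apply/wL/(tl_subst HL).
have goodS (p q : X) : good p -> RX p q -> good q.
  by move=> gp pq chi Lchi V; apply: (gp _ (tl_nec HL Lchi) V).
have goodP (p q : X) : good p -> RX q p -> good q.
  move=> gp qp chi Lchi V; apply: contrapT => nq.
  by apply: (gp _ (logic_past_nec HL Lchi) V); exists q.
(* The good worlds are closed under successors and predecessors, so their inclusion into [B] is a
   bounded morphism. *)
pose T : finType := {p : X | `[< good p >]}.
pose RT (p q : T) := RX (val p) (val q).
have goodT (p : T) : good (val p) by apply/asboolP; exact: (valP p).
have [e0 [_ _ e0good]] := emb _ _ CM0.
have T0 : inhabited T.
  by constructor; exists (e0 w0); apply/asboolP; exact: e0good.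
pose FT := Frame RT T0.
have valm : bounded_morphism (val : FT -> B).
  split=> // p q pq.
    have gq : good q by exact: goodS pq.
    by exists (Sub q (asboolT gq) : T); rewrite ?SubK // /RT /= /RT SubK.
  have gq : good q by exact: goodP pq.
  by exists (Sub q (asboolT gq) : T); rewrite ?SubK // /RT /= /RT SubK.
exists T, RT, T0 => psi; split=> [Lpsi V p|val_psi].
  pose V' n (x : B) := exists2 q : T, val q = x & V n q.
  have -> : V = (fun n q => V' n (val q)).
    apply/funext => n; apply/funext => q; apply/propext.
    by split=> [Vq|[q' /val_inj-> //]]; exists q.
  by apply/(sat_morphism V' psi p valm)/goodT.
apply: contrapT => nL.
have [W [m [CM [w nw]]]] := canonical_modelP HL LS nL.
have [h [hinj [hom fwd bwd] hgood]] := emb _ _ CM.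
pose e u : FT := Sub (h u) (asboolT (hgood u)) : T.
have eK u : val (e u) = h u by exact: SubK.
have em : bounded_morphism e.
  split=> [u v uv|u q uq|u q uq].
  - by rewrite /= /RT !eK; exact: hom.
  - have [|v uv Ev] := fwd u (val q); first by rewrite -eK.
    by exists v => //; apply/val_inj; rewrite eK.
  - have [|v uv Ev] := bwd u (val q); first by rewrite -eK.
    by exists v => //; apply/val_inj; rewrite eK.
(* Copy the canonical valuation along the injective [e]; [psi] then fails at [e w] by the truth
   lemma. *)
pose V n (p : FT) := exists2 u, val p = h u & m u (Var n).
have := val_psi V (e w); rewrite -(sat_morphism V psi w em).
have -> : (fun n u => V n (e u)) = (fun n u => m u (Var n)).
  apply/funext => n; apply/funext => u; apply/propext.
  split=> [[v]|mu]; last by exists u.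
  by rewrite eK => /hinj->.
by rewrite (truth CM) subst_Var.
Qed.

(** * Soundness of frame validity *)

Lemma prop_eval_sat (F : frame) (V : nat -> F -> Prop) x phi :
  prop_eval (fun psi => `[< sat V x psi >]) phi = `[< sat V x phi >].
Proof.
elim: phi => [p||a IHa b IHb|a _|a _] //=; first by apply/esym/asboolP.
by rewrite IHa IHb asbool_imply.
Qed.

Lemma sat_subst (F : frame) (V : nat -> F -> Prop) s x phi :
  sat (fun n y => sat V y (s n)) x phi <-> sat V x (subst s phi).
Proof.
elim: phi x => [p||a IHa b IHb|a IHa|a IHa] x //=.
- by rewrite IHa IHb.
- by split=> H y /H/IHa.
- by split=> -[y yx /IHa]; exists y.
Qed.

Lemma tense_logic_valid (F : frame) : tense_logic (valid F).
Proof.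
split.
- by move=> phi taut V x; apply/asboolP; rewrite -prop_eval_sat.
- by move=> phi psi V x /= Himp Hphi y xy; apply: Himp (Hphi y xy).
- move=> phi psi; split=> H V x /=.
    by move=> sx y xy; apply: H; exists x.
  by case=> y yx sy; exact: (H V y sy x yx).
- by move=> phi psi Himp Hphi V x; exact: (Himp V x (Hphi V x)).
- by move=> phi Hphi V x y _; exact: Hphi.
- by move=> s phi Hphi V x; apply/sat_subst.
Qed.

Lemma tense_logic_oplus L phi : tense_logic (oplus L phi).
Proof.
split=> [a|a b|a b|a b|a|s a].
- by move=> ta L' HL' _ _; exact: (tl_taut HL').
- by move=> L' HL' _ _; exact: (tl_K HL').
- by split=> H L' HL' sub Lphi; apply/(tl_adj HL'); exact: H HL' sub Lphi.
- by move=> Hab Ha L' HL' sub Lphi; exact: (tl_mp HL' (Hab L' HL' sub Lphi) (Ha L' HL' sub Lphi)).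
- by move=> Ha L' HL' sub Lphi; exact: (tl_nec HL' (Ha L' HL' sub Lphi)).
- by move=> Ha L' HL' sub Lphi; exact: (tl_subst HL' _ (Ha L' HL' sub Lphi)).
Qed.

Lemma zframe_valid_S43t s l r n chi : S43t chi -> valid (zframe s l r n) chi.
Proof.
apply; split=> [x|x y z|x y].
- by have := zacc_total s l r n x x; rewrite orbb.
- exact: zacc_trans.
- by apply/orP; exact: zacc_total.
Qed.

(** Fails exactly where [Var i] is the first true variable, hence at different worlds for different
    [i]. *)
Definition not_first i := foldr (fun j => Imp (Neg (Var j))) (Neg (Var i)) (iota 0 i).

(** A disjunction of future and past possibility, which on a linear frame reaches every world. *)
Definition occurs_first i := Imp (Box (not_first i)) (PDia (Neg (not_first i))).

(* On a linear frame with at least [n] worlds this is refuted by letting [Var i],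
   for [i < n], hold at distinct worlds. *)
Definition few n := foldr (fun i => Imp (occurs_first i)) Bot (iota 0 n).

Lemma sat_foldr_imp (F : frame) (V : nat -> F -> Prop) x g a s :
  sat V x (foldr (fun i : nat => Imp (g i)) a s) <->
  ((forall i, i \in s -> sat V x (g i)) -> sat V x a).
Proof.
elim: s => [|j s IHs] /=; first by split=> // H; apply: H.
rewrite IHs; split=> [H Hs|H Hj Hs]; last first.
  by apply: H => i; rewrite inE => /orP[/eqP->//|/Hs].
by apply: H => [|i si]; apply: Hs; rewrite inE ?eqxx ?si ?orbT.
Qed.

Lemma not_firstP (F : frame) (V : nat -> F -> Prop) x i :
  ~ sat V x (not_first i) <-> V i x /\ forall j, j < i -> ~ V j x.
Proof.
rewrite /not_first sat_foldr_imp /=; split=> [H|[Vi nV] H].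
  split=> [|j lt_ji Vj]; apply: contrapT => nVi; apply: H => // H Vi.
  by apply: (H j) Vj; rewrite mem_iota.
by apply: H Vi => j; rewrite mem_iota => /nV.
Qed.

Lemma valid_few (T : finType) (R : T -> T -> Prop) (T0 : inhabited T) n :
  #|T| < n -> valid (Frame R T0) (few n).
Proof.
move=> lt_n V x; apply/sat_foldr_imp => occ /=.
have ex (i : 'I_n) : exists y : T, V i y /\ forall j, j < i -> ~ V j y.
  have : sat (F := Frame R T0) V x (occurs_first i) by apply: occ; rewrite mem_iota /=.
  move=> H; apply: contrapT => nex.
  have nf y : sat (F := Frame R T0) V y (not_first i).
    by apply: contrapT => /not_firstP ?; apply: nex; exists y.
  by case: H => [y _|y _]; [exact: nf|apply; exact: nf].
have [y yP] := fin_all_exists ex.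
have yinj : injective y.
  move=> i j Eij; apply/val_inj; have [Vi ni] := yP i; have [Vj nj] := yP j.
  case: (ltngtP i j) => // lt.
    by case: (nj i lt); rewrite -Eij.
  by case: (ni j lt); rewrite Eij.
by have := leq_card y yinj; rewrite card_ord leqNgt lt_n.
Qed.

Lemma refuted_few s l r n m : m <= n.+1 -> refuted (zframe s l r n) (few m).
Proof.
move=> le_m; apply/refutedP; exists (fun i (y : 'I_n.+1) => i = y :> nat), ord0.
rewrite sat_foldr_imp /= => H; apply: H => i; rewrite mem_iota /= add0n => lt_i Hbox.
have lt_in : i < n.+1 by exact: leq_trans le_m.
suff nsat : ~ sat (F := zframe s l r n) (fun i (y : 'I_n.+1) => i = y :> nat)
    (Ordinal lt_in) (not_first i).
  by case: nsat; exact: Hbox.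
by apply/not_firstP; split=> // j /[swap] -> /=; rewrite ltnn.
Qed.

(** If the logic is that of [T], it contains [few #|T|.+1], which would hold in any [zframe]
    validating [phi]; large ones refute it. *)
Lemma tabular_families phi : tabular (oplus S43t phi) <->
  valid (zframe false 0 0 0) phi /\ (forall k, k \in families -> refuted_family k phi).
Proof.
have HL := tense_logic_oplus S43t phi.
have LS chi : S43t chi -> oplus S43t phi chi by move=> ? L' _ + _; apply.
have Lphi : oplus S43t phi phi by move=> L'.
split=> [[T [R [T0 LT]]]|[one fams]].
  split=> [|[[s l] r] kF].
    apply: contrapT => nval.
    have cons : ~ oplus S43t phi Bot.
      by move=> /LT H; case: (T0) => t; exact: (H (fun _ _ => True) t).
    have [W [m [CM _]]] := canonical_modelP HL LS cons.
    have eq0 (t : 'I_1) : ord0 = t by rewrite ord1.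
    apply: (no_morphism HL CM (h := fun=> ord0 : zframe false 0 0 0)) Lphi nval _ _ _.
    - by split=> // w q _; exists w => //; exact: (cm_refl CM).
    - by move=> t; apply: (definable_const CM).
    - by move=> t; have [w] := world_inhabited W; exists w.
  (* Large enough both to refute [few #|T|.+1] and to meet the bound [2 <= n]. *)
  pose n := #|T| + 2; exists n; first exact: leq_addl.
  move=> val_phi.
  have /LT few_L : valid (Frame R T0) (few #|T|.+1) by exact: valid_few.
  have := few_L _ (tense_logic_valid _) (@zframe_valid_S43t s l r n) val_phi.
  by apply: refuted_few; rewrite /n; lia.
have [N bound] := finite_model_bound fams.
have cons : ~ oplus S43t phi Bot.
  move=> /(_ _ (tense_logic_valid (zframe false 0 0 0)) (@zframe_valid_S43t _ _ _ _) one).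
  by move/(_ (fun _ _ => True) ord0).
by apply: (tabular_finite HL LS cons) => W m CM; exact: bound HL Lphi CM.
Qed.

Theorem theorem6p12 :
  decidable_formulas (fun phi : formula => tabular (oplus S43t phi)).
Proof.
(* The double negation normalizes the value of [tdecide] to 0 or 1. *)
exists (fun v => eval (tnot (tnot tdecide)) v); first exact: env_recursive_eval.
move=> phi; rewrite eval_not holds_not negbK -/(tval _).
split=> [/tabular_families/decide_spec -> //|ntab].
by case: (boolP (holds _ _)) => // /decide_spec/tabular_families.
Qed.
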